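(* Let $(\mathcal{T},\chi,\psi)$ be a double comonoidal monad on a duoidal category $(\mathsf{C},\diamond,I,\star,J)$. Then $(\mathsf{C}^{\mathcal{T}},\diamond,I,\star,J)$ is a duoidal category.
   Context: Monoidal categories are treated as if strict. **Duoidal category.** A category $\mathsf{C}$ with two monoidal structures $(\diamond,I)$, $(\star,J)$, a natural transformation (interchange law) $\zeta_{A,B,C,D}:(A\star B)\diamond(C\star D)\to(A\diamond C)\star(B\diamond D)$ and unit maps $\delta:I\to I\star I$, $\theta:J\diamond J\to J$, $\zeta_0:I\to J$ such that: $\zeta(\zeta\diamond\mathrm{id})=\zeta(\mathrm{id}\diamond\zeta)$ as maps $(A\star X)\diamond(B\star Y)\diamond(C\star Z)\to(A\diamond B\diamond C)\star(X\diamond Y\diamond Z)$; $(\zeta\star\mathrm{id})\zeta=(\mathrm{id}\star\zeta)\zeta$ as maps $(A\star B\star C)\diamond(X\star Y\star Z)\to(A\diamond X)\star(B\diamond Y)\star(C\diamond Z)$; the composites $A\star B=I\diamond(A\star B)\xrightarrow{\delta\diamond\mathrm{id}}(I\star I)\diamond(A\star B)\xrightarrow{\zeta}(I\diamond A)\star(I\diamond B)=A\star B$ and $A\diamond B=(J\star A)\diamond(J\star B)\xrightarrow{\zeta}(J\diamond J)\star(A\diamond B)\xrightarrow{\theta\star\mathrm{id}}J\star(A\diamond B)=A\diamond B$, and their right-handed versions, are identities; $(J,\theta,\zeta_0)$ is a monoid in $(\mathsf{C},\diamond,I)$; $(I,\delta,\zeta_0)$ is a comonoid in $(\mathsf{C},\star,J)$.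 **Double comonoidal monad.** A monad $(\mathcal{T},\mu,\eta)$ on a monoidal category is comonoidal if the functor carries a colax monoidal structure for which $\mu,\eta$ are morphisms of comonoidal functors. A double comonoidal monad on $\mathsf{C}$ is a monad $\mathcal{T}$ with structures $\chi_{X,Y}:\mathcal{T}(X\diamond Y)\to\mathcal{T}X\diamond\mathcal{T}Y$, $\chi_0:\mathcal{T}I\to I$ and $\psi_{X,Y}:\mathcal{T}(X\star Y)\to\mathcal{T}X\star\mathcal{T}Y$, $\psi_0:\mathcal{T}J\to J$ making it comonoidal on $(\mathsf{C},\diamond,I)$ and on $(\mathsf{C},\star,J)$ respectively, such that $\zeta\circ(\psi\diamond\psi)\circ\chi=(\chi\star\chi)\circ\psi\circ\mathcal{T}\zeta$ as maps $\mathcal{T}((A\star B)\diamond(C\star D))\to(\mathcal{T}A\diamond\mathcal{T}C)\star(\mathcal{T}B\diamond\mathcal{T}D)$; $\delta\circ\chi_0=(\chi_0\star\chi_0)\circ\psi_{I,I}\circ\mathcal{T}\delta$; $\psi_0\circ\mathcal{T}\theta=\theta\circ(\psi_0\diamond\psi_0)\circ\chi_{J,J}$; $\psi_0\circ\mathcal{T}\zeta_0=\zeta_0\circ\chi_0$. **Structure on $\mathsf{C}^{\mathcal{T}}$.** For $\mathcal{T}$-algebras $(A,a)$, $(B,b)$, $A\diamond B$ is an algebra via $(a\diamond b)\circ\chi_{A,B}$ and $A\star B$ via $(a\star b)\circ\psi_{A,B}$; $I$ and $J$ are algebras via $\chi_0$ and $\psi_0$. The interchange law and unit maps on $\mathsf{C}^{\mathcal{T}}$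 are those of $\mathsf{C}$. *)

(* Defs.v *)
From Stdlib Require Import ProofIrrelevance.

Set Implicit Arguments.
Unset Strict Implicit.
Unset Printing Implicit Defensive.

Declare Scope cat_scope.
Delimit Scope cat_scope with cat.
Local Open Scope cat_scope.

Record category := Category {
  Ob :> Type;
  Hom : Ob -> Ob -> Type;
  idc : forall A, Hom A A;
  compc : forall A B D, Hom B D -> Hom A B -> Hom A D;
  compc_idl : forall A B (f : Hom A B), compc (idc B) f = f;
  compc_idr : forall A B (f : Hom A B), compc f (idc A) = f;
  compcA : forall A B D E (h : Hom D E) (g : Hom B D) (f : Hom A B),
    compc h (compc g f) = compc (compc h g) f
}.

Arguments Hom {c} A B.
Arguments idc {c} A.
Arguments compc {c A B D} g f.

Notation "g ∘ f" := (compc g f) (at level 40, left associativity) : cat_scope.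

Definition is_iso (C : category) (A B : C) (f : Hom A B) : Prop :=
  exists g : Hom B A, g ∘ f = idc A /\ f ∘ g = idc B.

Record functor (C D : category) := Functor {
  fobj :> C -> D;
  fmap : forall A B : C, Hom A B -> Hom (fobj A) (fobj B);
  fmap_id : forall A : C, fmap (idc A) = idc (fobj A);
  fmap_comp : forall (A B E : C) (g : Hom B E) (f : Hom A B),
    fmap (g ∘ f) = fmap g ∘ fmap f
}.

Arguments fmap {C D} F {A B} f : rename.

Definition functor_id (C : category) : functor C C :=
  @Functor C C (fun A => A) (fun _ _ f => f)
    (fun _ => eq_refl) (fun _ _ _ _ _ => eq_refl).

Lemma fcomp_id (C D E : category) (G : functor D E) (F : functor C D) (A : C) :
  fmap G (fmap F (idc A)) = idc (G (F A)).
Proof. now rewrite !fmap_id. Qed.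

Lemma fcomp_comp (C D E : category) (G : functor D E) (F : functor C D)
    (A B X : C) (g : Hom B X) (f : Hom A B) :
  fmap G (fmap F (g ∘ f)) = fmap G (fmap F g) ∘ fmap G (fmap F f).
Proof. now rewrite !fmap_comp. Qed.

Definition functor_comp (C D E : category) (G : functor D E) (F : functor C D) :
    functor C E :=
  @Functor C E (fun A => G (F A)) (fun _ _ f => fmap G (fmap F f))
    (fcomp_id G F) (@fcomp_comp C D E G F).

Definition is_natural (C D : category) (F G : functor C D)
    (t : forall A : C, Hom (F A) (G A)) : Prop :=
  forall (A B : C) (f : Hom A B), t B ∘ fmap F f = fmap G f ∘ t A.

(** Associators and unitors are explicit, so that strict monoidal categories
    are the special case where they are identities. Operations and axioms are
    kept apart because the operations on the category of algebras are
    prescribed. *)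

Record monoidal_data (C : category) := MonoidalData {
  tens : C -> C -> C;
  tensm : forall A A' B B' : C,
    Hom A A' -> Hom B B' -> Hom (tens A B) (tens A' B');
  munit : C;
  massoc : forall A B D : C, Hom (tens (tens A B) D) (tens A (tens B D));
  mlunit : forall A : C, Hom (tens munit A) A;
  mrunit : forall A : C, Hom (tens A munit) A
}.

Arguments tens {C} M A B : rename.
Arguments tensm {C} M {A A' B B'} f g : rename.
Arguments munit {C} M : rename.
Arguments massoc {C} M A B D : rename.
Arguments mlunit {C} M A : rename.
Arguments mrunit {C} M A : rename.

Record is_monoidal (C : category) (M : monoidal_data C) : Prop := IsMonoidal {
  tensm_id : forall A B : C, tensm M (idc A) (idc B) = idc (tens M A B);
  tensm_comp : forall (A A' A'' B B' B'' : C)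
      (f' : Hom A' A'') (f : Hom A A') (g' : Hom B' B'') (g : Hom B B'),
    tensm M (f' ∘ f) (g' ∘ g) = tensm M f' g' ∘ tensm M f g;
  massoc_nat : forall (A A' B B' D D' : C)
      (f : Hom A A') (g : Hom B B') (h : Hom D D'),
    massoc M A' B' D' ∘ tensm M (tensm M f g) h
    = tensm M f (tensm M g h) ∘ massoc M A B D;
  mlunit_nat : forall (A A' : C) (f : Hom A A'),
    mlunit M A' ∘ tensm M (idc (munit M)) f = f ∘ mlunit M A;
  mrunit_nat : forall (A A' : C) (f : Hom A A'),
    mrunit M A' ∘ tensm M f (idc (munit M)) = f ∘ mrunit M A;
  massoc_iso : forall A B D : C, is_iso (massoc M A B D);
  mlunit_iso : forall A : C, is_iso (mlunit M A);
  mrunit_iso : forall A : C, is_iso (mrunit M A);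
  pentagon : forall A B D E : C,
    massoc M A B (tens M D E) ∘ massoc M (tens M A B) D E
    = tensm M (idc A) (massoc M B D E) ∘ massoc M A (tens M B D) E
      ∘ tensm M (massoc M A B D) (idc E);
  triangle : forall A B : C,
    tensm M (idc A) (mlunit M B) ∘ massoc M A (munit M) B
    = tensm M (mrunit M A) (idc B)
}.

Record is_monoid (C : category) (M : monoidal_data C) (A : C)
    (m : Hom (tens M A A) A) (u : Hom (munit M) A) : Prop := IsMonoid {
  monoid_assoc : m ∘ tensm M m (idc A) = m ∘ tensm M (idc A) m ∘ massoc M A A A;
  monoid_unitl : m ∘ tensm M u (idc A) = mlunit M A;
  monoid_unitr : m ∘ tensm M (idc A) u = mrunit M A
}.

Record is_comonoid (C : category) (M : monoidal_data C) (A : C)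
    (d : Hom A (tens M A A)) (e : Hom A (munit M)) : Prop := IsComonoid {
  comonoid_assoc : massoc M A A A ∘ tensm M d (idc A) ∘ d = tensm M (idc A) d ∘ d;
  comonoid_unitl : mlunit M A ∘ tensm M e (idc A) ∘ d = idc A;
  comonoid_unitr : mrunit M A ∘ tensm M (idc A) e ∘ d = idc A
}.

Record duoidal_data (C : category) := DuoidalData {
  dia : monoidal_data C;
  star : monoidal_data C;
  zeta : forall A B X Y : C,
    Hom (tens dia (tens star A B) (tens star X Y))
        (tens star (tens dia A X) (tens dia B Y));
  delta : Hom (munit dia) (tens star (munit dia) (munit dia));
  theta : Hom (tens dia (munit star) (munit star)) (munit star);
  zeta0 : Hom (munit dia) (munit star)
}.

Arguments dia {C} D : rename.
Arguments star {C} D : rename.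
Arguments zeta {C} D A B X Y : rename.
Arguments delta {C} D : rename.
Arguments theta {C} D : rename.
Arguments zeta0 {C} D : rename.

Notation "A ⋄[ D ] B" := (tens (dia D) A B)
  (at level 35, D at level 200, no associativity, format "A  ⋄[ D ]  B") : cat_scope.
Notation "A ⋆[ D ] B" := (tens (star D) A B)
  (at level 35, D at level 200, no associativity, format "A  ⋆[ D ]  B") : cat_scope.
Notation "f ⋄m[ D ] g" := (tensm (dia D) f g)
  (at level 35, D at level 200, no associativity, format "f  ⋄m[ D ]  g") : cat_scope.
Notation "f ⋆m[ D ] g" := (tensm (star D) f g)
  (at level 35, D at level 200, no associativity, format "f  ⋆m[ D ]  g") : cat_scope.

Record is_duoidal (C : category) (D : duoidal_data C) : Prop := IsDuoidal {
  dia_monoidal : is_monoidal (dia D);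
  star_monoidal : is_monoidal (star D);
  zeta_nat : forall (A A' B B' X X' Y Y' : C)
      (f : Hom A A') (g : Hom B B') (h : Hom X X') (k : Hom Y Y'),
    zeta D A' B' X' Y' ∘ ((f ⋆m[D] g) ⋄m[D] (h ⋆m[D] k))
    = ((f ⋄m[D] h) ⋆m[D] (g ⋄m[D] k)) ∘ zeta D A B X Y;
  (* ((A ⋆ X) ⋄ (B ⋆ Y)) ⋄ (E ⋆ Z) -> (A ⋄ (B ⋄ E)) ⋆ (X ⋄ (Y ⋄ Z)) *)
  zeta_dia_assoc : forall A X B Y E Z : C,
    (massoc (dia D) A B E ⋆m[D] massoc (dia D) X Y Z)
      ∘ zeta D (A ⋄[D] B) (X ⋄[D] Y) E Z
      ∘ (zeta D A X B Y ⋄m[D] idc (E ⋆[D] Z))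
    = zeta D A X (B ⋄[D] E) (Y ⋄[D] Z)
      ∘ (idc (A ⋆[D] X) ⋄m[D] zeta D B Y E Z)
      ∘ massoc (dia D) (A ⋆[D] X) (B ⋆[D] Y) (E ⋆[D] Z);
  (* ((A ⋆ B) ⋆ E) ⋄ ((X ⋆ Y) ⋆ Z) -> (A ⋄ X) ⋆ ((B ⋄ Y) ⋆ (E ⋄ Z)) *)
  zeta_star_assoc : forall A B E X Y Z : C,
    massoc (star D) (A ⋄[D] X) (B ⋄[D] Y) (E ⋄[D] Z)
      ∘ (zeta D A B X Y ⋆m[D] idc (E ⋄[D] Z))
      ∘ zeta D (A ⋆[D] B) E (X ⋆[D] Y) Z
    = (idc (A ⋄[D] X) ⋆m[D] zeta D B E Y Z)
      ∘ zeta D A (B ⋆[D] E) X (Y ⋆[D] Z)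
      ∘ (massoc (star D) A B E ⋄m[D] massoc (star D) X Y Z);
  delta_unitl : forall A B : C,
    (mlunit (dia D) A ⋆m[D] mlunit (dia D) B)
      ∘ zeta D (munit (dia D)) (munit (dia D)) A B
      ∘ (delta D ⋄m[D] idc (A ⋆[D] B))
    = mlunit (dia D) (A ⋆[D] B);
  delta_unitr : forall A B : C,
    (mrunit (dia D) A ⋆m[D] mrunit (dia D) B)
      ∘ zeta D A B (munit (dia D)) (munit (dia D))
      ∘ (idc (A ⋆[D] B) ⋄m[D] delta D)
    = mrunit (dia D) (A ⋆[D] B);
  theta_unitl : forall A B : C,
    mlunit (star D) (A ⋄[D] B)
      ∘ (theta D ⋆m[D] idc (A ⋄[D] B))
      ∘ zeta D (munit (star D)) A (munit (star D)) B
    = mlunit (star D) A ⋄m[D] mlunit (star D) B;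
  theta_unitr : forall A B : C,
    mrunit (star D) (A ⋄[D] B)
      ∘ (idc (A ⋄[D] B) ⋆m[D] theta D)
      ∘ zeta D A (munit (star D)) B (munit (star D))
    = mrunit (star D) A ⋄m[D] mrunit (star D) B;
  J_monoid : is_monoid (M := dia D) (theta D) (zeta0 D);
  I_comonoid : is_comonoid (M := star D) (delta D) (zeta0 D)
}.

Record duoidal_category := DuoidalCategory {
  duo_cat :> category;
  duo_data : duoidal_data duo_cat;
  duo_laws : is_duoidal duo_data
}.

Record comonoidal_data (C : category) (M : monoidal_data C)
    (C' : category) (M' : monoidal_data C') (F : functor C C') := ComonoidalData {
  cotens : forall X Y : C, Hom (F (tens M X Y)) (tens M' (F X) (F Y));
  counit : Hom (F (munit M)) (munit M')
}.

Arguments cotens {C M C' M' F} c X Y.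
Arguments counit {C M C' M' F} c.

Record is_comonoidal (C : category) (M : monoidal_data C)
    (C' : category) (M' : monoidal_data C') (F : functor C C')
    (chi : comonoidal_data M M' F) : Prop := IsComonoidal {
  cotens_nat : forall (X X' Y Y' : C) (f : Hom X X') (g : Hom Y Y'),
    cotens chi X' Y' ∘ fmap F (tensm M f g)
    = tensm M' (fmap F f) (fmap F g) ∘ cotens chi X Y;
  cotens_assoc : forall X Y Z : C,
    massoc M' (F X) (F Y) (F Z)
      ∘ tensm M' (cotens chi X Y) (idc (F Z)) ∘ cotens chi (tens M X Y) Z
    = tensm M' (idc (F X)) (cotens chi Y Z) ∘ cotens chi X (tens M Y Z)
      ∘ fmap F (massoc M X Y Z);
  cotens_unitl : forall X : C,
    mlunit M' (F X) ∘ tensm M' (counit chi) (idc (F X)) ∘ cotens chi (munit M) X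
    = fmap F (mlunit M X);
  cotens_unitr : forall X : C,
    mrunit M' (F X) ∘ tensm M' (idc (F X)) (counit chi) ∘ cotens chi X (munit M)
    = fmap F (mrunit M X)
}.

Definition comonoidal_id (C : category) (M : monoidal_data C) :
    comonoidal_data M M (functor_id C) :=
  @ComonoidalData C M C M (functor_id C)
    (fun X Y => idc (tens M X Y)) (idc (munit M)).

Definition comonoidal_comp (C C' C'' : category) (M : monoidal_data C)
    (M' : monoidal_data C') (M'' : monoidal_data C'')
    (G : functor C' C'') (F : functor C C')
    (gam : comonoidal_data M' M'' G) (chi : comonoidal_data M M' F) :
    comonoidal_data M M'' (functor_comp G F) :=
  @ComonoidalData C M C'' M'' (functor_comp G F)
    (fun X Y => cotens gam (F X) (F Y) ∘ fmap G (cotens chi X Y))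
    (counit gam ∘ fmap G (counit chi)).

Record is_comonoidal_morphism (C : category) (M : monoidal_data C)
    (C' : category) (M' : monoidal_data C') (F G : functor C C')
    (chi : comonoidal_data M M' F) (gam : comonoidal_data M M' G)
    (t : forall A : C, Hom (F A) (G A)) : Prop := IsComonoidalMorphism {
  comor_tens : forall X Y : C,
    cotens gam X Y ∘ t (tens M X Y) = tensm M' (t X) (t Y) ∘ cotens chi X Y;
  comor_unit : counit gam ∘ t (munit M) = counit chi
}.

Record monad (C : category) := Monad {
  mfun :> functor C C;
  mu : forall A : C, Hom (mfun (mfun A)) (mfun A);
  eta : forall A : C, Hom A (mfun A);
  mu_nat : is_natural (F := functor_comp mfun mfun) (G := mfun) mu;
  eta_nat : is_natural (F := functor_id C) (G := mfun) eta;
  mu_assoc : forall A : C, mu A ∘ mu (mfun A) = mu A ∘ fmap mfun (mu A);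
  mu_etal : forall A : C, mu A ∘ eta (mfun A) = idc (mfun A);
  mu_etar : forall A : C, mu A ∘ fmap mfun (eta A) = idc (mfun A)
}.

Arguments mu {C} T A : rename.
Arguments eta {C} T A : rename.

Record is_comonoidal_monad (C : category) (M : monoidal_data C) (T : monad C)
    (chi : comonoidal_data M M T) : Prop := IsComonoidalMonad {
  comonad_fun : is_comonoidal chi;
  comonad_mu : is_comonoidal_morphism (comonoidal_comp chi chi) chi (mu T);
  comonad_eta : is_comonoidal_morphism (comonoidal_id M) chi (eta T)
}.

Record is_double_comonoidal (C : category) (D : duoidal_data C) (T : monad C)
    (chi : comonoidal_data (dia D) (dia D) T)
    (psi : comonoidal_data (star D) (star D) T) : Prop := IsDoubleComonoidal {
  double_dia : is_comonoidal_monad chi;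
  double_star : is_comonoidal_monad psi;
  double_zeta : forall A B X Y : C,
    zeta D (T A) (T B) (T X) (T Y) ∘ (cotens psi A B ⋄m[D] cotens psi X Y)
      ∘ cotens chi (A ⋆[D] B) (X ⋆[D] Y)
    = (cotens chi A X ⋆m[D] cotens chi B Y) ∘ cotens psi (A ⋄[D] X) (B ⋄[D] Y)
      ∘ fmap T (zeta D A B X Y);
  double_delta :
    delta D ∘ counit chi
    = (counit chi ⋆m[D] counit chi) ∘ cotens psi (munit (dia D)) (munit (dia D))
      ∘ fmap T (delta D);
  double_theta :
    counit psi ∘ fmap T (theta D)
    = theta D ∘ (counit psi ⋄m[D] counit psi)
      ∘ cotens chi (munit (star D)) (munit (star D));
  double_zeta0 : counit psi ∘ fmap T (zeta0 D) = zeta0 D ∘ counit chi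
}.

Record double_comonoidal_monad (C : duoidal_category) := DoubleComonoidalMonad {
  dcm_monad :> monad C;
  dcm_chi : comonoidal_data (dia (duo_data C)) (dia (duo_data C)) dcm_monad;
  dcm_psi : comonoidal_data (star (duo_data C)) (star (duo_data C)) dcm_monad;
  dcm_laws : is_double_comonoidal dcm_chi dcm_psi
}.

Record is_algebra (C : category) (T : monad C) (A : C) (a : Hom (T A) A) : Prop :=
  IsAlgebra {
    alg_unit : a ∘ eta T A = idc A;
    alg_mult : a ∘ mu T A = a ∘ fmap T a
  }.

Record algebra (C : category) (T : monad C) := Algebra {
  carrier :> C;
  act : Hom (T carrier) carrier;
  act_alg : is_algebra act
}.

Definition is_alg_hom (C : category) (T : monad C) (A B : C)
    (a : Hom (T A) A) (b : Hom (T B) B) (f : Hom A B) : Prop :=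
  f ∘ a = b ∘ fmap T f.

Record alg_hom (C : category) (T : monad C) (A B : algebra T) := AlgHom {
  alg_map :> Hom A B;
  alg_map_hom : is_alg_hom (act A) (act B) alg_map
}.

Section AlgebraCategory.
Context {C : category} (T : monad C).

Lemma alg_hom_eq (A B : algebra T) (f g : alg_hom A B) :
  alg_map f = alg_map g -> f = g.
Proof.
destruct f as [f Hf], g as [g Hg]; simpl; intros e; subst g.
now rewrite (proof_irrelevance _ Hf Hg).
Qed.

Lemma is_alg_hom_id (A : algebra T) : is_alg_hom (act A) (act A) (idc A).
Proof. now unfold is_alg_hom; rewrite fmap_id, compc_idl, compc_idr. Qed.

Lemma is_alg_hom_comp (A B D : algebra T) (g : alg_hom B D) (f : alg_hom A B) :
  is_alg_hom (act A) (act D) (g ∘ f).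
Proof.
unfold is_alg_hom.
now rewrite <- compcA, (alg_map_hom f), compcA, (alg_map_hom g), <- compcA, fmap_comp.
Qed.

Definition alg_id (A : algebra T) : alg_hom A A := AlgHom (is_alg_hom_id A).
Definition alg_comp (A B D : algebra T) (g : alg_hom B D) (f : alg_hom A B) :
  alg_hom A D := AlgHom (is_alg_hom_comp g f).

Lemma alg_comp_idl (A B : algebra T) (f : alg_hom A B) : alg_comp (alg_id B) f = f.
Proof. apply alg_hom_eq, compc_idl. Qed.

Lemma alg_comp_idr (A B : algebra T) (f : alg_hom A B) : alg_comp f (alg_id A) = f.
Proof. apply alg_hom_eq, compc_idr. Qed.

Lemma alg_compA (A B D E : algebra T)
    (h : alg_hom D E) (g : alg_hom B D) (f : alg_hom A B) :
  alg_comp h (alg_comp g f) = alg_comp (alg_comp h g) f.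
Proof. apply alg_hom_eq, compcA. Qed.

Definition alg_category : category :=
  @Category (algebra T) (@alg_hom C T) alg_id alg_comp
    alg_comp_idl alg_comp_idr alg_compA.

End AlgebraCategory.

(** The objects and morphisms of [C] involved are prescribed; that they are
    algebras and algebra morphisms is not assumed but collected in the
    propositions [lifts_monoidal] and [lifts_duoidal]. A proof of these turns
    the prescribed formulas into operations on [alg_category T]. *)

Section MonoidalLift.
Context {C : category} {M : monoidal_data C} {T : monad C}.
Context (chi : comonoidal_data M M T).

Definition tens_act (A B : C) (a : Hom (T A) A) (b : Hom (T B) B) :
  Hom (T (tens M A B)) (tens M A B) := tensm M a b ∘ cotens chi A B.

Record lifts_monoidal : Prop := LiftsMonoidal {
  lift_tens : forall A B : algebra T, is_algebra (tens_act (act A) (act B));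
  lift_unit : is_algebra (counit chi);
  lift_tensm : forall (A A' B B' : algebra T) (f : alg_hom A A') (g : alg_hom B B'),
    is_alg_hom (tens_act (act A) (act B)) (tens_act (act A') (act B'))
      (tensm M f g);
  lift_assoc : forall A B E : algebra T,
    is_alg_hom (tens_act (tens_act (act A) (act B)) (act E))
      (tens_act (act A) (tens_act (act B) (act E))) (massoc M A B E);
  lift_lunit : forall A : algebra T,
    is_alg_hom (tens_act (counit chi) (act A)) (act A) (mlunit M A);
  lift_runit : forall A : algebra T,
    is_alg_hom (tens_act (act A) (counit chi)) (act A) (mrunit M A)
}.

Context (L : lifts_monoidal).

Definition alg_tens (A B : algebra T) : algebra T := Algebra (lift_tens L A B).

Definition alg_munit : algebra T := Algebra (lift_unit L).

Definition alg_monoidal : monoidal_data (alg_category T) :=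
  @MonoidalData (alg_category T) alg_tens
    (fun A A' B B' f g =>
       @AlgHom C T (alg_tens A B) (alg_tens A' B') _ (lift_tensm L f g))
    alg_munit
    (fun A B E =>
       @AlgHom C T (alg_tens (alg_tens A B) E) (alg_tens A (alg_tens B E)) _
         (lift_assoc L A B E))
    (fun A => @AlgHom C T (alg_tens alg_munit A) A _ (lift_lunit L A))
    (fun A => @AlgHom C T (alg_tens A alg_munit) A _ (lift_runit L A)).

End MonoidalLift.

Section DuoidalLift.
Context {C : duoidal_category} (T : double_comonoidal_monad C).

Let D := duo_data C.
Let chi := dcm_chi T.
Let psi := dcm_psi T.

Record lifts_duoidal : Prop := LiftsDuoidal {
  lift_dia : lifts_monoidal chi;
  lift_star : lifts_monoidal psi;
  lift_zeta : forall A B X Y : algebra T,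
    is_alg_hom
      (tens_act chi (tens_act psi (act A) (act B)) (tens_act psi (act X) (act Y)))
      (tens_act psi (tens_act chi (act A) (act X)) (tens_act chi (act B) (act Y)))
      (zeta D A B X Y);
  lift_delta :
    is_alg_hom (counit chi) (tens_act psi (counit chi) (counit chi)) (delta D);
  lift_theta :
    is_alg_hom (tens_act chi (counit psi) (counit psi)) (counit psi) (theta D);
  lift_zeta0 : is_alg_hom (counit chi) (counit psi) (zeta0 D)
}.

Context (L : lifts_duoidal).

Definition alg_duoidal : duoidal_data (alg_category T) :=
  let dA := alg_monoidal (lift_dia L) in
  let sA := alg_monoidal (lift_star L) in
  @DuoidalData (alg_category T) dA sA
    (fun A B X Y =>
       @AlgHom C T (tens dA (tens sA A B) (tens sA X Y))
         (tens sA (tens dA A X) (tens dA B Y)) _ (lift_zeta L A B X Y))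
    (@AlgHom C T (munit dA) (tens sA (munit dA) (munit dA)) _ (lift_delta L))
    (@AlgHom C T (tens dA (munit sA) (munit sA)) (munit sA) _ (lift_theta L))
    (@AlgHom C T (munit dA) (munit sA) _ (lift_zeta0 L)).

End DuoidalLift.

(* Main.v *)
Require Import Defs.

(** A morphism of algebras is determined by its underlying morphism in [C], so
    every equation required of [alg_category T] is an instance of the same
    equation in [C]. What has to be proved is that the structure of [C] lifts:
    the compatibility of [chi] with the monad, the unitors and the associator
    says that tensor products of algebras are algebras and that the constraints
    are algebra morphisms, and the four axioms of a double comonoidal monad say
    the same of [zeta], [delta], [theta] and [zeta0]. *)

Set Implicit Arguments.
Unset Strict Implicit.
Unset Printing Implicit Defensive.

Local Open Scope cat_scope.

Section AlgebraIso.
Context {C : category} {T : monad C}.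

(** Isomorphisms must be reflected from [C] because associators and unitors are not identities here:
    their inverses have to be algebra morphisms too. *)
Lemma is_alg_hom_inverse (A B : C) (a : Hom (T A) A) (b : Hom (T B) B)
    (f : Hom A B) (g : Hom B A) :
  is_alg_hom a b f -> g ∘ f = idc A -> f ∘ g = idc B -> is_alg_hom b a g.
Proof.
unfold is_alg_hom; intros Hf gf fg.
(* Inserts [fmap T f ∘ fmap T g] after [g ∘ b], so that [Hf] turns [b ∘ fmap T f] into [f ∘ a] and
   [g] cancels [f]. *)
rewrite <- (compc_idr (g ∘ b)), <- fmap_id, <- fg, fmap_comp.
now rewrite compcA, <- (compcA g), <- Hf, (compcA g), gf, compc_idl.
Qed.

Lemma alg_is_iso (A B : algebra T) (f : alg_hom A B) :
  is_iso (alg_map f) -> is_iso (C := alg_category T) f.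
Proof.
intros [g [gf fg]].
exists (AlgHom (is_alg_hom_inverse (alg_map_hom f) gf fg)).
split; apply alg_hom_eq; assumption.
Qed.

End AlgebraIso.

Section MonoidalLift.
Context {C : category} {M : monoidal_data C} {T : monad C}.
Context {chi : comonoidal_data M M T}.
Context (HM : is_monoidal M) (Hchi : is_comonoidal_monad chi).

Lemma tensm_compl (A A' A'' B B' : C)
    (f' : Hom A' A'') (f : Hom A A') (g : Hom B B') :
  tensm M (f' ∘ f) g = tensm M f' g ∘ tensm M f (idc B).
Proof. now rewrite <- (tensm_comp HM), compc_idr. Qed.

Lemma tensm_compr (A A' B B' B'' : C)
    (f : Hom A A') (g' : Hom B' B'') (g : Hom B B') :
  tensm M f (g' ∘ g) = tensm M f g' ∘ tensm M (idc A) g.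
Proof. now rewrite <- (tensm_comp HM), compc_idr. Qed.

(** The unit law comes from comonoidality of [eta]; the multiplication law from comonoidality of
    [mu] together with naturality of [cotens chi]. *)
Lemma tens_act_is_algebra (A B : C) (a : Hom (T A) A) (b : Hom (T B) B) :
  is_algebra a -> is_algebra b -> is_algebra (tens_act chi a b).
Proof.
intros [ua ma] [ub mb]; unfold tens_act; split.
- pose proof (comor_tens (comonad_eta Hchi) A B) as E; simpl in E.
  rewrite <- compcA, E.
  now rewrite compc_idr, <- (tensm_comp HM), ua, ub, (tensm_id HM).
- pose proof (comor_tens (comonad_mu Hchi) A B) as E; simpl in E.
  rewrite <- compcA, E.
  rewrite compcA, <- (tensm_comp HM), ma, mb, (tensm_comp HM), fmap_comp.
  rewrite !compcA; f_equal; rewrite <- !compcA; f_equal.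
  symmetry; apply (cotens_nat (comonad_fun Hchi)).
Qed.

(** The two algebra laws are the unit components of comonoidality of [eta] and [mu]. *)
Lemma counit_is_algebra : is_algebra (counit chi).
Proof.
split.
- apply (comor_unit (comonad_eta Hchi)).
- apply (comor_unit (comonad_mu Hchi)).
Qed.

Lemma tensm_is_alg_hom (A A' B B' : C) (a : Hom (T A) A) (a' : Hom (T A') A')
    (b : Hom (T B) B) (b' : Hom (T B') B') (f : Hom A A') (g : Hom B B') :
  is_alg_hom a a' f -> is_alg_hom b b' g ->
  is_alg_hom (tens_act chi a b) (tens_act chi a' b') (tensm M f g).
Proof.
unfold is_alg_hom, tens_act; intros Hf Hg.
rewrite compcA, <- (tensm_comp HM), Hf, Hg, (tensm_comp HM), <- !compcA.
now rewrite (cotens_nat (comonad_fun Hchi)).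
Qed.

(** Naturality of [massoc] pulls the three actions to the left; what remains is coassociativity of
    [cotens chi]. *)
Lemma massoc_is_alg_hom (A B E : C)
    (a : Hom (T A) A) (b : Hom (T B) B) (e : Hom (T E) E) :
  is_alg_hom (tens_act chi (tens_act chi a b) e)
    (tens_act chi a (tens_act chi b e)) (massoc M A B E).
Proof.
unfold is_alg_hom, tens_act.
rewrite tensm_compl, tensm_compr, !compcA, (massoc_nat HM), <- !compcA.
f_equal; rewrite !compcA; apply (cotens_assoc (comonad_fun Hchi)).
Qed.

Lemma mlunit_is_alg_hom (A : C) (a : Hom (T A) A) :
  is_alg_hom (tens_act chi (counit chi) a) a (mlunit M A).
Proof.
unfold is_alg_hom, tens_act.
(* Counitality expands [fmap T (mlunit M A)], and naturality then moves [a] inside the tensor, next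
   to [counit chi]. *)
rewrite <- (cotens_unitl (comonad_fun Hchi)), !compcA, <- (mlunit_nat HM).
now rewrite <- (compcA _ _ (tensm M (counit chi) _)), <- (tensm_comp HM), compc_idl, compc_idr.
Qed.

Lemma mrunit_is_alg_hom (A : C) (a : Hom (T A) A) :
  is_alg_hom (tens_act chi a (counit chi)) a (mrunit M A).
Proof.
unfold is_alg_hom, tens_act.
rewrite <- (cotens_unitr (comonad_fun Hchi)), !compcA, <- (mrunit_nat HM).
now rewrite <- (compcA _ _ (tensm M _ (counit chi))), <- (tensm_comp HM), compc_idl, compc_idr.
Qed.

Lemma comonoidal_monad_lifts : lifts_monoidal chi.
Proof.
split; intros.
- apply tens_act_is_algebra; apply act_alg.
- apply counit_is_algebra.
- apply tensm_is_alg_hom; apply alg_map_hom.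
- apply massoc_is_alg_hom.
- apply mlunit_is_alg_hom.
- apply mrunit_is_alg_hom.
Qed.

Lemma alg_is_monoidal (L : lifts_monoidal chi) : is_monoidal (alg_monoidal L).
Proof.
(* The [try] leaves the three [is_iso] goals untouched, since they are not equations. *)
split; intros; try (apply alg_hom_eq; simpl).
- apply (tensm_id HM).
- apply (tensm_comp HM).
- apply (massoc_nat HM).
- apply (mlunit_nat HM).
- apply (mrunit_nat HM).
- apply alg_is_iso, (massoc_iso HM).
- apply alg_is_iso, (mlunit_iso HM).
- apply alg_is_iso, (mrunit_iso HM).
- apply (pentagon HM).
- apply (triangle HM).
Qed.

End MonoidalLift.

Section DuoidalLift.
Context {C : duoidal_category} (T : double_comonoidal_monad C).

Let D := duo_data C.
Let HD : is_duoidal D := duo_laws C.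
Let HT := dcm_laws T.

(** Naturality of [zeta] moves the four actions past it, leaving exactly [double_zeta]. *)
Lemma zeta_is_alg_hom (A B X Y : C) (a : Hom (T A) A) (b : Hom (T B) B)
    (x : Hom (T X) X) (y : Hom (T Y) Y) :
  is_alg_hom
    (tens_act (dcm_chi T) (tens_act (dcm_psi T) a b) (tens_act (dcm_psi T) x y))
    (tens_act (dcm_psi T) (tens_act (dcm_chi T) a x) (tens_act (dcm_chi T) b y))
    (zeta D A B X Y).
Proof.
unfold is_alg_hom, tens_act.
rewrite (tensm_comp (dia_monoidal HD)), (tensm_comp (star_monoidal HD)).
rewrite !compcA, (zeta_nat HD), <- !compcA.
f_equal; rewrite !compcA; apply (double_zeta HT).
Qed.

Lemma double_comonoidal_monad_lifts : lifts_duoidal T.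
Proof.
split.
- apply (comonoidal_monad_lifts (dia_monoidal HD) (double_dia HT)).
- apply (comonoidal_monad_lifts (star_monoidal HD) (double_star HT)).
- intros; apply zeta_is_alg_hom.
- apply (double_delta HT).
- unfold is_alg_hom, tens_act; rewrite compcA.
  symmetry; apply (double_theta HT).
- symmetry; apply (double_zeta0 HT).
Qed.

(** Any [L] will do: the underlying morphisms of [alg_duoidal L] do not depend on the proofs in
    [L]. *)
Lemma alg_is_duoidal (L : lifts_duoidal T) : is_duoidal (alg_duoidal L).
Proof.
split; intros; try (apply alg_hom_eq; simpl).
- apply (alg_is_monoidal (dia_monoidal HD)).
- apply (alg_is_monoidal (star_monoidal HD)).
- apply (zeta_nat HD).
- apply (zeta_dia_assoc HD).
- apply (zeta_star_assoc HD).
- apply (delta_unitl HD).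
- apply (delta_unitr HD).
- apply (theta_unitl HD).
- apply (theta_unitr HD).
- destruct (J_monoid HD); split; apply alg_hom_eq; assumption.
- destruct (I_comonoid HD); split; apply alg_hom_eq; assumption.
Qed.

End DuoidalLift.

Theorem theorem7p2 (C : duoidal_category) (T : double_comonoidal_monad C) :
  exists L : lifts_duoidal T, is_duoidal (alg_duoidal L).
Proof.
exists (double_comonoidal_monad_lifts T).
apply alg_is_duoidal.
Qed.
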